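(* For $a_0,b_0,b_1,b_2\in\mathbb{R}$ let $A(t)=a_0-\sin t-a_0\cos t$, $B(t)=b_0+b_1\sin t+b_2\cos t$, and consider the Abel equation $x'=A(t)x^3+B(t)x^2$ on $[0,T]$ with $T=2\pi$. For each $b_1,b_2$ with $b_2>0$ there exists a neighbourhood of $(a_0,b_0)=(0,0)$ such that, for all $(a_0,b_0)$ in that neighbourhood, the following hold: $(C_1)$ $A(0)=0$; $A$ has exactly one zero $t_A$ in $(0,2\pi)$, and it is simple; $B$ has exactly two zeros $t_{B_1},t_{B_2}$ in $[0,2\pi]$, both simple; and $0<t_{B_1}<t_A<t_{B_2}\le2\pi$; and for any singular positive closed solution $\tilde u(t)$ of the equation: $(C_2)$ the function $2A(t)\tilde u(t)+B(t)$ has at most one zero, simple if it exists, in each of the intervals $[0,t_A]$ and $[t_A,2\pi]$; $(C_3)$ $\operatorname{sgn}(v(t,\tilde u(t)))=\operatorname{sgn}(A'(0)B(0))$ for all $t\in[0,2\pi]$.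
   Context: Let $u(t,x)$ be the solution with $u(0,x)=x$. It is closed if it is defined on $[0,2\pi]$ and $u(2\pi,x)=x$, positive if $x>0$; a closed solution $u(t,\tilde x)$ is singular if $u_x(2\pi,\tilde x)=1$. Here $P(t)=4(B(t)A'(t)-B'(t)A(t))-B(t)^3$ and $v(t,x)=B(t)(2A(t)x+B(t))^2+P(t)$. *)

(* Defs.v *)
From Stdlib Require Import Reals.
From Coquelicot Require Import Coquelicot.
Open Scope R_scope.

(** Derivatives in [t] are taken relative to the compact interval [0,T]
    (one-sided at the endpoints), by means of [D_in]. *)

Definition solution (A B : R -> R) (T x0 : R) (x : R -> R) : Prop :=
  x 0 = x0 /\
  forall t, 0 <= t <= T ->
    D_in x (fun s => A s * x s ^ 3 + B s * x s ^ 2) (fun s => 0 <= s <= T) t.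

(** [u t x] is the value at time [t] of the solution with value [x] at time 0.
    The solution from a given [x] may blow up before time [T], so [u] is only
    constrained for [x] near [x0]; this determines [u t x] for such [x] and
    [0 <= t <= T].  If the solution from [x0] is defined on [0,T], such a [u]
    exists by continuous dependence on initial conditions. *)
Definition flow_near (A B : R -> R) (T x0 : R) (u : R -> R -> R) : Prop :=
  locally x0 (fun x => solution A B T x (fun t => u t x)).

Definition closed_solution (A B : R -> R) (T x0 : R) (x : R -> R) : Prop :=
  solution A B T x0 x /\ x T = x0.

Definition singular_closed_solution (A B : R -> R) (T x0 : R)
    (u : R -> R -> R) : Prop :=
  flow_near A B T x0 u /\
  closed_solution A B T x0 (fun t => u t x0) /\
  is_derive (fun x => u T x) x0 1.

Definition simple_zero (T : R) (f : R -> R) (t : R) : Prop :=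
  f t = 0 /\
  exists l : R, l <> 0 /\ D_in f (fun _ => l) (fun s => 0 <= s <= T) t.

Definition at_most_one_simple_zero (T : R) (f : R -> R) (a b : R) : Prop :=
  (forall s t, a <= s <= b -> a <= t <= b -> f s = 0 -> f t = 0 -> s = t) /\
  (forall t, a <= t <= b -> f t = 0 -> simple_zero T f t).

Definition P (A B : R -> R) (t : R) : R :=
  4 * (B t * Derive A t - Derive B t * A t) - B t ^ 3.

Definition v (A B : R -> R) (t x : R) : R :=
  B t * (2 * A t * x + B t) ^ 2 + P A B t.

Definition cond_C1 (A B : R -> R) (T tA tB1 tB2 : R) : Prop :=
  A 0 = 0 /\
  (0 < tA < T /\ simple_zero T A tA /\
   forall t, 0 < t < T -> A t = 0 -> t = tA) /\
  (simple_zero T B tB1 /\ simple_zero T B tB2 /\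
   forall t, 0 <= t <= T -> B t = 0 -> t = tB1 \/ t = tB2) /\
  (0 < tB1 /\ tB1 < tA /\ tA < tB2 /\ tB2 <= T).

Definition cond_C2 (A B : R -> R) (T tA : R) (x : R -> R) : Prop :=
  at_most_one_simple_zero T (fun t => 2 * A t * x t + B t) 0 tA /\
  at_most_one_simple_zero T (fun t => 2 * A t * x t + B t) tA T.

Definition cond_C3 (A B : R -> R) (T : R) (x : R -> R) : Prop :=
  forall t, 0 <= t <= T -> sign (v A B t (x t)) = sign (Derive A 0 * B 0).

Definition Atrig (a0 t : R) : R := a0 - sin t - a0 * cos t.

Definition Btrig (b0 b1 b2 t : R) : R := b0 + b1 * sin t + b2 * cos t.

(* Main.v *)
Require Import Defs.
From Stdlib Require Import Reals Lra Psatz.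
From Coquelicot Require Import Coquelicot.
Open Scope R_scope.

(** The idea is that positive closed solutions are uniformly
    small when [(a0, b0)] is close to [(0, 0)], and that for a small solution
    the conditions only depend on the Wronskian [B' A - B A'], which is close to
    [b2 > 0].

    Smallness rests on the absence of positive closed solutions at
    [a0 = b0 = 0].  There [w = 1 / x] satisfies
    [w' = sin t / w - b1 * sin t - b2 * cos t].  Let [w1 t = w (2 * PI - t)].
    The difference [d = w1 - w] solves
    [d' = - p * d + 2 * b2 * cos t] with [p = sin t / (w * w1) > 0] on
    [(0, PI)], and [d 0 = d PI = 0] if [w] is closed.  But
    [D = d - 2 * b2 * sin t] solves [D' = - p * (D + 2 * b2 * sin t)], which
    forces [D] to be nonpositive from [D 0 = 0], and nonnegative near [PI] from
    [D PI = 0], although it strictly decreases where it vanishes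
    ([damped_no_return]).

    This argument is stable under perturbation as long as [w] is bounded above,
    i.e. [x] is bounded below: [p] is then bounded below in the middle of the
    interval, and the perturbation [a0 * (1 - cos t) * (1 / w + 1 / w1)] is
    controlled by a lower bound of [w] around [PI], which holds for every
    solution whatever its initial value ([reciprocal_lower_bound]).  This is
    [no_bounded_closed_reciprocal].  As [w] has bounded speed for [w >= 1], a
    solution is either small on the whole period or bounded below on it
    ([reciprocal_drift]), with constants that depend on [b1] and [b2] only.

    For the conditions themselves, if [h' A - h A' > 0] then [h / A] increases
    between zeros of [A], so that [h] has at most one zero there
    ([wronskian_one_zero]).  This applies to [h = B] and, when the solution [x]
    is small, to [h = 2 A x + B]; and [v] is then close to
    [- 4 * (B' A - B A') < 0]. *)

(** * Derivatives on a compact interval *)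

(** Continuing [x] affinely past both ends of the interval turns one-sided
    derivatives into two-sided ones, so that the calculus of [is_derive] and
    the mean value theorem apply up to the endpoints. *)
Lemma D_in_extend (x f : R -> R) (T : R) :
  0 < T ->
  (forall t, 0 <= t <= T -> D_in x f (fun s => 0 <= s <= T) t) ->
  exists y : R -> R,
    forall t, 0 <= t <= T -> y t = x t /\ is_derive y t (f t).
Proof.
intros HT H.
pose (y := fun t => if Rlt_dec t 0 then x 0 + f 0 * t
                    else if Rlt_dec T t then x T + f T * (t - T) else x t).
assert (Hin : forall t, 0 <= t <= T -> y t = x t).
{ intros t Ht; unfold y.
  destruct (Rlt_dec t 0); [lra|]; destruct (Rlt_dec T t); [lra|reflexivity]. }
exists y; intros t Ht; split; [now apply Hin|].
apply is_derive_Reals; intros eps Heps.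
destruct (H t Ht eps Heps) as [d [Hd Hq]].
pose (r := if Rlt_dec 0 t then t else T).
pose (q := if Rlt_dec t T then T - t else T).
assert (Hr : 0 < r) by (unfold r; destruct (Rlt_dec 0 t); lra).
assert (Hq' : 0 < q) by (unfold q; destruct (Rlt_dec t T); lra).
assert (Hm : 0 < Rmin d (Rmin r q)) by (repeat apply Rmin_glb_lt; lra).
exists (mkposreal _ Hm); intros h Hh0 Hh; simpl in Hh.
assert (Hhd : Rabs h < d) by (eapply Rlt_le_trans; [exact Hh|apply Rmin_l]).
assert (Hhr : Rabs h < r).
{ eapply Rlt_le_trans; [exact Hh|]; eapply Rle_trans; [apply Rmin_r|apply Rmin_l]. }
assert (Hhq : Rabs h < q).
{ eapply Rlt_le_trans; [exact Hh|]; eapply Rle_trans; [apply Rmin_r|apply Rmin_r]. }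
apply Rabs_def2 in Hhr; apply Rabs_def2 in Hhq.
rewrite (Hin t Ht).
destruct (Rlt_dec (t + h) 0) as [Hl|Hl].
- unfold r in Hhr; destruct (Rlt_dec 0 t) as [Ht0|Ht0]; [lra|].
  assert (t = 0) by lra; subst t.
  unfold y; destruct (Rlt_dec (0 + h) 0); [|lra].
  replace ((x 0 + f 0 * (0 + h) - x 0) / h - f 0) with 0 by (field; lra).
  now rewrite Rabs_R0.
- destruct (Rlt_dec T (t + h)) as [Hu|Hu].
  + unfold q in Hhq; destruct (Rlt_dec t T) as [HtT|HtT]; [lra|].
    assert (t = T) by lra; subst t.
    unfold y; destruct (Rlt_dec (T + h) 0); [lra|].
    destruct (Rlt_dec T (T + h)); [|lra].
    replace ((x T + f T * (T + h - T) - x T) / h - f T) with 0 by (field; lra).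
    now rewrite Rabs_R0.
  + rewrite Hin by lra.
    specialize (Hq (t + h)); unfold Rdist in Hq; simpl in Hq.
    unfold Rdist in Hq; replace (t + h - t) with h in Hq by ring.
    apply Hq; repeat split; lra.
Qed.

Lemma is_derive_D_in (y x : R -> R) (D : R -> Prop) (t l : R) :
  (forall s, D s -> y s = x s) -> D t -> is_derive y t l ->
  D_in x (fun _ => l) D t.
Proof.
intros He Ht Hy eps Heps.
apply is_derive_Reals in Hy.
destruct (Hy eps Heps) as [d Hd].
exists d; split; [apply cond_pos|].
intros s [[Hs Hne] Hst]; simpl in *; unfold Rdist in *.
specialize (Hd (s - t)).
replace (t + (s - t)) with s in Hd by ring.
rewrite <- (He s Hs), <- (He t Ht); apply Hd; [lra|exact Hst].
Qed.

(** * Comparison *)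

(** Each comparison between a solution and an explicit function below is an
    instance of this: [f] is the gap between them, and at a contact the
    differential equation shows that the gap is opening.  The condition is
    asked also at [t = a], where [f] may start at 0.  At the last point before
    [t] where [f] is nonnegative, [f] vanishes and increases, so that the
    point was not the last one. *)
Lemma barrier (f : R -> R) (a b : R) :
  (forall t, a <= t <= b -> exists l, is_derive f t l /\ (f t = 0 -> 0 < l)) ->
  0 <= f a -> forall t, a <= t <= b -> 0 <= f t.
Proof.
intros Hf Ha t Ht.
destruct (Rle_lt_dec 0 (f t)) as [|Hneg]; [assumption|exfalso].
pose (E := fun r => a <= r <= t /\ 0 <= f r).
assert (HEa : E a) by (unfold E; lra).
destruct (completeness E) as [s [Hub Hlub]].
{ exists t; intros r [Hr _]; lra. }
{ now exists a. }
assert (Has : a <= s) by now apply Hub.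
assert (Hst : s <= t) by (apply Hlub; intros r [Hr _]; lra).
destruct (Hf s) as [l [Hl Hl0]]; [lra|].
assert (Hc : continuity_pt f s).
{ apply derivable_continuous_pt; exists l; now apply is_derive_Reals. }
assert (Hright : forall r, s < r <= t -> f r < 0).
{ intros r Hr; apply Rnot_le_lt; intros H.
  assert (r <= s); [apply Hub; unfold E|]; lra. }
destruct (Rtotal_order (f s) 0) as [Hs|[Hs|Hs]].
- destruct (Hc (- f s)) as [d [Hd Hcd]]; [lra|].
  assert (Hub' : is_upper_bound E (s - d / 2)).
  { intros r [Hr Hfr]; apply Rnot_lt_le; intros Hlt.
    assert (r <= s) by (apply Hub; unfold E; lra).
    destruct (Req_dec r s) as [->|Hne]; [lra|].
    assert (Hx : Rabs (f r - f s) < - f s).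
    { apply (Hcd r); split.
      - split; [exact I|]; intros E'; apply Hne; now symmetry.
      - simpl; unfold Rdist; apply Rabs_def1; lra. }
    apply Rabs_def2 in Hx; lra. }
  apply Hlub in Hub'; lra.
- assert (Hst' : s < t) by (destruct (Req_dec s t) as [->|]; lra).
  specialize (Hl0 Hs); apply is_derive_Reals in Hl.
  destruct (Hl l Hl0) as [d Hd].
  pose (h := Rmin (d / 2) (t - s)).
  assert (Hh : 0 < h) by (pose proof (cond_pos d); apply Rmin_glb_lt; lra).
  assert (Hhd : h < d).
  { pose proof (cond_pos d); pose proof (Rmin_l (d / 2) (t - s)); unfold h; lra. }
  assert (Hht : h <= t - s) by apply Rmin_r.
  assert (Hfr : f (s + h) < 0) by (apply Hright; lra).
  assert (Hx := Hd h).
  rewrite Rabs_pos_eq in Hx by lra.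
  assert (Hx' : Rabs ((f (s + h) - f s) / h - l) < l) by (apply Hx; lra).
  apply Rabs_def2 in Hx'; rewrite Hs in Hx'.
  assert (Hpos : 0 < (f (s + h) - 0) / h) by lra.
  apply (Rmult_lt_compat_r h) in Hpos; [|lra].
  unfold Rdiv in Hpos; rewrite Rmult_assoc, Rinv_l in Hpos by lra; lra.
- assert (Hst' : s < t) by (destruct (Req_dec s t) as [->|]; lra).
  destruct (Hc (f s)) as [d [Hd Hcd]]; [lra|].
  pose (h := Rmin (d / 2) (t - s)).
  assert (Hh : 0 < h) by (apply Rmin_glb_lt; lra).
  assert (Hhd : h < d).
  { pose proof (Rmin_l (d / 2) (t - s)); unfold h; lra. }
  assert (Hht : h <= t - s) by apply Rmin_r.
  assert (Hfr : f (s + h) < 0) by (apply Hright; lra).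
  assert (Hx : Rabs (f (s + h) - f s) < f s).
  { apply (Hcd (s + h)); split.
    - split; [exact I|]; lra.
    - simpl; unfold Rdist; apply Rabs_def1; lra. }
  apply Rabs_def2 in Hx; lra.
Qed.

(** * The reciprocal equation *)

(** The equation satisfied by [w = 1 / x] when [x' = A x ^ 3 + B x ^ 2] and
    [x > 0]: it is singular at [w = 0] and has bounded speed for [w >= 1]. *)
Definition reciprocal_solution (A B : R -> R) (a b : R) (w : R -> R) : Prop :=
  forall t, a <= t <= b -> is_derive w t (- (A t / w t) - B t).

Lemma sin_sq_cos_sq (t : R) : sin t * sin t + cos t * cos t = 1.
Proof. exact (sin2_cos2 t). Qed.

Lemma Atrig_derive (a0 t : R) : is_derive (Atrig a0) t (- cos t + a0 * sin t).
Proof. unfold Atrig; auto_derive; [exact I|ring]. Qed.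

Lemma Btrig_derive (b0 b1 b2 t : R) :
  is_derive (Btrig b0 b1 b2) t (b1 * cos t - b2 * sin t).
Proof. unfold Btrig; auto_derive; [exact I|ring]. Qed.

Lemma sin_le_id (x : R) : 0 <= x -> sin x <= x.
Proof.
intros [Hx|<-]; [left; now apply sin_lt_x|rewrite sin_0; lra].
Qed.

(** Slightly past [PI] the sine has changed sign but is still negligible,
    while the cosine is far from 0. *)
Lemma sin_cos_past_PI (d t : R) :
  0 <= d <= 1 / 2 -> PI <= t <= PI + d ->
  - d <= sin t <= 0 /\ cos t <= - (1 / 2).
Proof.
intros Hd Ht.
pose proof PI2_1.
pose (r := t - PI).
assert (Hr : 0 <= r <= d) by (unfold r; lra).
replace t with (r + PI) by (unfold r; ring).
rewrite neg_sin, neg_cos.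
assert (H1 := sin_le_id r (proj1 Hr)).
assert (H2 : 0 <= sin r) by (apply sin_ge_0; lra).
assert (H3 : 0 <= cos r) by (apply cos_ge_0; lra).
assert (H4 := sin_sq_cos_sq r).
split; [lra|nra].
Qed.

(** The singular term [sin t / w] of the equation pushes [w] away from 0 for
    [t < PI], and at [t = PI], where it dies out, [- B] is about [b2 > 0] and
    takes over; by continuity it still does on a short interval beyond [PI].
    Hence [c * (1 - cos t)] is a lower barrier on [[0, PI + d]] when [c] and
    then [d] are small.  The barrier vanishes at 0, which makes [c] and [d]
    independent of [w 0]. *)
Lemma reciprocal_lower_bound (b1 b2 : R) :
  0 < b2 ->
  exists c d : R, 0 < c /\ 0 < d <= 1 / 2 /\
    forall (a0 b0 : R) (w : R -> R),
      Rabs a0 / c + Rabs b0 <= b2 / 8 ->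
      0 < w 0 ->
      reciprocal_solution (Atrig a0) (Btrig b0 b1 b2) 0 (PI + d) w ->
      forall t, 0 <= t <= PI + d -> c * (1 - cos t) <= w t.
Proof.
intros Hb2.
pose (i := 2 * (Rabs b1 + 2 * b2 + 2)).
assert (Hb1 := Rabs_pos b1).
assert (Hi : 4 < i) by (unfold i; lra).
pose (c := / i).
assert (Hc : 0 < c) by (apply Rinv_0_lt_compat; lra).
assert (Hci : c * i = 1) by (unfold c; field; lra).
assert (Hc1 : c < 1 / 4) by nra.
assert (Hd : exists d, 0 < d <= 1 / 2 /\ d * (i + Rabs b1) <= b2 / 8).
{ pose (m := b2 / 8 / (i + Rabs b1)).
  assert (Hm : 0 < m) by (apply Rdiv_lt_0_compat; lra).
  assert (Hm' : m * (i + Rabs b1) = b2 / 8) by (unfold m; field; lra).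
  exists (Rmin (1 / 2) m); split; [split|].
  - apply Rmin_glb_lt; lra.
  - apply Rmin_l.
  - rewrite <- Hm'; apply Rmult_le_compat_r; [lra|apply Rmin_r]. }
destruct Hd as [d [Hd Hdi]].
exists c, d; split; [assumption|]; split; [assumption|].
intros a0 b0 w Hsmall Hw0 Hw t Ht.
assert (Hsm : Rabs a0 * i + Rabs b0 <= b2 / 8).
{ replace (Rabs a0 * i) with (Rabs a0 / c) by (unfold c; field; lra); exact Hsmall. }
clear Hsmall.
apply Rminus_le_0.
apply (barrier (fun t => w t - c * (1 - cos t)) 0 (PI + d)); [|rewrite cos_0; lra|exact Ht].
clear t Ht; intros t Ht.
exists (- (Atrig a0 t / w t) - Btrig b0 b1 b2 t - c * sin t); split.
{ assert (H := Hw t Ht); auto_derive; [eexists; eassumption|].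
  rewrite (is_derive_unique (fun x : R => w x) _ _ H); ring. }
cbv beta; intros Htouch.
assert (Ht0 : 0 < t).
{ destruct (Req_dec t 0) as [->|]; [rewrite cos_0 in Htouch|]; lra. }
pose proof PI2_1.
replace (w t) with (c * (1 - cos t)) by lra.
unfold Atrig, Btrig.
assert (Hsc := sin_sq_cos_sq t).
assert (Hg : 0 < 1 - cos t).
{ assert (cos t <> 1); [|pose proof (COS_bound t); lra].
  intros Hct.
  destruct (Rle_lt_dec t PI) as [Hle|Hlt].
  - assert (cos t < cos 0); [apply cos_decreasing_1; lra|rewrite cos_0 in *; lra].
  - destruct (sin_cos_past_PI d t); lra. }
assert (Ha0 : - (Rabs a0 * i) <= a0 * i <= Rabs a0 * i).
{ pose proof (Rle_abs a0); pose proof (Rle_abs (- a0)); rewrite Rabs_Ropp in *; nra. }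
assert (Hb0 : - Rabs b0 <= b0 <= Rabs b0).
{ pose proof (Rle_abs b0); pose proof (Rle_abs (- b0)); rewrite Rabs_Ropp in *; lra. }
assert (Hb1' : - Rabs b1 <= b1 <= Rabs b1).
{ pose proof (Rle_abs b1); pose proof (Rle_abs (- b1)); rewrite Rabs_Ropp in *; lra. }
(* q stays of order 1 or larger while cos t >= - 1 / 2: it is (1 + cos t) / sin t. *)
pose (q := sin t / (1 - cos t)).
assert (Hq : q * (1 - cos t) = sin t) by (unfold q; field; lra).
replace (- ((a0 - sin t - a0 * cos t) / (c * (1 - cos t))))
  with (q * i - a0 * i) by (unfold q, c; field; lra).
assert (Hs1 := SIN_bound t); assert (Hc1' := COS_bound t).
set (s := sin t) in *; set (co := cos t) in *.
destruct (Rle_lt_dec t PI) as [Hle|Hlt].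
- assert (Hs : 0 <= s) by (apply sin_ge_0; lra).
  assert (Hb1s : b1 * s <= Rabs b1 * s) by nra.
  destruct (Rle_lt_dec co (- (1 / 2))) as [Hco|Hco].
  + assert (Hq2 : s / 2 <= q) by nra.
    assert (Hqi : s * (Rabs b1 + 2 * b2 + 2) <= q * i) by (unfold i in *; nra).
    nra.
  + assert (Hqs : q * s = 1 + co).
    { apply (Rmult_eq_reg_r (1 - co)); [|lra].
      replace (q * s * (1 - co)) with (q * (1 - co) * s) by ring; rewrite Hq; nra. }
    assert (Hq2 : 1 / 2 <= q) by nra.
    assert (Hqi : Rabs b1 + 2 * b2 + 2 <= q * i) by (unfold i in *; nra).
    nra.
- destruct (sin_cos_past_PI d t) as [Hs Hco]; [lra|lra|].
  fold s in Hs; fold co in Hco.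
  assert (Hqd : - d <= q) by nra.
  assert (Hqi : - (d * i) <= q * i) by nra.
  assert (Hb1s : b1 * s <= d * Rabs b1) by nra.
  nra.
Qed.

(** * No closed solution away from zero *)

(** For [eta = 0] the damping keeps [D] below 0 and pulls it towards
    [- b * sin t], so that [D] becomes negative; going back in time from
    [D PI = 0] the same inequality makes [D] nonnegative near [PI].  With the
    error [eta] both statements hold up to a multiple of [eta], and the drop
    of [D] on an interval where [p >= m] exceeds that error. *)
Lemma damped_no_return (D dD p : R -> R) (eta m b : R) :
  (forall t, 0 <= t <= PI -> is_derive D t (dD t)) ->
  (forall t, 0 <= t <= PI ->
     0 <= p t /\ dD t <= - p t * (D t + b * sin t) + eta / 4) ->
  (forall t, 2 * PI / 3 <= t <= 5 * PI / 6 -> m <= p t) ->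
  0 < eta -> 0 < m <= 1 -> 64 * eta < m * b -> D 0 = 0 -> D PI <> 0.
Proof.
intros HD Hp Hm Heta Hm0 Hmb D0 D1.
pose proof PI2_1; pose proof PI_4.
assert (Hb : 64 * eta < b) by nra.
assert (Hup : forall t, 0 <= t <= PI -> 0 <= eta * t - D t).
{ apply barrier; [|lra].
  intros t Ht; exists (eta - dD t); split.
  - assert (H' := HD t Ht); auto_derive; [eexists; eassumption|].
    rewrite (is_derive_unique (fun x : R => D x) _ _ H'); ring.
  - cbv beta; intros Htouch; destruct (Hp t Ht) as [Hp0 Hd].
    assert (0 <= sin t) by (apply sin_ge_0; lra).
    assert (0 <= p t * (D t + b * sin t)) by (apply Rmult_le_pos; nra).
    lra. }
assert (Hlow : forall s, 0 <= s <= PI / 3 -> 0 <= D (PI - s) + eta * sin s).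
{ apply barrier; [|rewrite Rminus_0_r, sin_0; lra].
  intros s Hs; exists (- dD (PI - s) + eta * cos s); split.
  - assert (H' : is_derive D (PI - s) (dD (PI - s))) by (apply HD; lra).
    auto_derive; [eexists; eassumption|].
    rewrite (is_derive_unique (fun x : R => D x) (PI + - s) _ H'); ring.
  - cbv beta; intros Htouch; destruct (Hp (PI - s)) as [Hp0 Hd]; [lra|].
    rewrite sin_PI_x in Hd.
    assert (0 <= sin s) by (apply sin_ge_0; lra).
    assert (1 / 2 <= cos s).
    { rewrite <- cos_PI3; apply cos_decr_1; lra. }
    assert (0 <= p (PI - s) * (D (PI - s) + b * sin s)) by (apply Rmult_le_pos; nra).
    assert (eta * (1 / 2) <= eta * cos s) by nra; lra. }
(* On a fixed interval the damping is effective and forces a definite drop. *)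
destruct (MVT_cor2 D dD (2 * PI / 3) (5 * PI / 6)) as [z [Hz Hzi]]; [lra| |].
{ intros t Ht; apply is_derive_Reals, HD; lra. }
assert (H1 := Hup (2 * PI / 3)); assert (H2 := Hlow (PI / 6)).
assert (H3 := Hlow (PI - z)).
replace (PI - (PI - z)) with z in H3 by ring.
replace (PI - PI / 6) with (5 * PI / 6) in H2 by field.
rewrite sin_PI_x in H3; rewrite sin_PI6 in H2.
assert (Hsz : 1 / 2 <= sin z).
{ rewrite <- sin_PI_x, <- sin_PI6; apply sin_incr_1; lra. }
pose proof (SIN_bound z).
destruct (Hp z) as [Hpz Hdz]; [lra|].
assert (Hmz := Hm z).
assert (Hdrop : dD z <= - (m * (b / 4)) + eta / 4).
{ assert (b / 4 <= D z + b * sin z) by nra.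
  assert (m * (b / 4) <= p z * (D z + b * sin z)) by (apply Rmult_le_compat; lra).
  lra. }
nra.
Qed.

(** [w] is compared with its reflection [w1 t = w (2 * PI - t)]; both have the
    same values at 0 and at [PI] when [w] is closed.  Subtracting
    [2 * b2 * sin t] from [w1 - w] removes the forcing [2 * b2 * cos t] from
    the equation of the difference and leaves
    [D' = - p * (D + 2 * b2 * sin t) + a0 * (1 - cos t) * (1 / w + 1 / w1)
    + 2 * b0] with [p = sin t / (w * w1)].  The only dangerous term is the one
    in [a0].  Away from [PI] it is absorbed by half of [2 * b2 * p * sin t],
    since [1 - cos t] is there bounded by a multiple of [sin t ^ 2]; near
    [PI] it is small, because [w] and [w1] are bounded below. *)
Lemma no_bounded_closed_reciprocal (b1 b2 M : R) :
  0 < b2 -> 1 <= M ->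
  locally_2d (fun a0 b0 : R =>
    forall w : R -> R,
      reciprocal_solution (Atrig a0) (Btrig b0 b1 b2) 0 (2 * PI) w ->
      (forall t, 0 <= t <= 2 * PI -> 0 < w t <= M) ->
      w (2 * PI) <> w 0) 0 0.
Proof.
intros Hb2 HM.
destruct (reciprocal_lower_bound b1 b2 Hb2) as [c [d [Hc [Hd Hlow]]]].
pose (m := / (M * M)).
assert (HMM : 1 <= M * M) by nra.
assert (Hm : 0 < m) by (apply Rinv_0_lt_compat; lra).
assert (HmM : m * (M * M) = 1) by (unfold m; field; lra).
assert (Hm1 : m <= 1) by nra.
(* p >= m / 2 on the middle interval, where sin t >= 1 / 2; the constant 65 meets
   64 * eta < (m / 2) * b2. *)
pose (eta := m / 2 * b2 / 65).
assert (Heta : 0 < eta) by (unfold eta; nra).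
pose (k := 1 - cos d).
pose proof PI2_1.
assert (Hk : 0 < k).
{ assert (cos d < cos 0); [apply cos_decreasing_1; lra|].
  rewrite cos_0 in *; unfold k; lra. }
(* The three bounds serve the lower barrier, the absorption away from PI, and the
   error left near PI. *)
pose (e := Rmin (Rmin (b2 / 8 / (/ c + 1)) (b2 * k / (2 * M))) (eta / 4 / (2 + 4 / c))).
assert (Hic : 0 < / c) by now apply Rinv_0_lt_compat.
assert (He : 0 < e).
{ repeat apply Rmin_glb_lt; apply Rdiv_lt_0_compat; unfold Rdiv; nra. }
exists (mkposreal e He); intros a0 b0 Ha Hb w Hw Hpos Hclosed; simpl in Ha, Hb.
rewrite Rminus_0_r in Ha, Hb.
assert (He1 : e * (/ c + 1) <= b2 / 8).
{ apply Rle_trans with (b2 / 8 / (/ c + 1) * (/ c + 1)); [|right; field; lra].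
  apply Rmult_le_compat_r; [lra|].
  eapply Rle_trans; [apply Rmin_l|apply Rmin_l]. }
assert (He2 : e * (2 * M) <= b2 * k).
{ apply Rle_trans with (b2 * k / (2 * M) * (2 * M)); [|right; field; lra].
  apply Rmult_le_compat_r; [lra|].
  eapply Rle_trans; [apply Rmin_l|apply Rmin_r]. }
assert (He3 : e * (2 + 4 * / c) <= eta / 4).
{ apply Rle_trans with (eta / 4 / (2 + 4 / c) * (2 + 4 * / c)).
  - apply Rmult_le_compat_r; [lra|apply Rmin_r].
  - right; field; lra. }
clearbody e; clear He.
assert (Hap := Rabs_pos a0); assert (Hbp := Rabs_pos b0).
assert (Ha0 := Rle_abs a0); assert (Hb0 := Rle_abs b0).
assert (Hlow' : forall t, 0 <= t <= PI + d -> c * (1 - cos t) <= w t).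
{ apply (Hlow a0 b0).
  - unfold Rdiv; nra.
  - apply Hpos; lra.
  - intros t Ht; apply Hw; lra. }
assert (Hnear : forall t, PI - d <= t <= PI + d -> c <= w t).
{ intros t Ht; assert (H1 := Hlow' t).
  assert (cos t <= 0); [apply cos_le_0; lra|nra]. }
pose (w1 := fun t => w (2 * PI - t)).
pose (D := fun t => w1 t - w t - 2 * b2 * sin t).
pose (dD := fun t => (a0 * (1 - cos t) * (w t + w1 t)
                     - sin t * (D t + 2 * b2 * sin t)) / (w t * w1 t) + 2 * b0).
refine (damped_no_return D dD (fun t => sin t / (w t * w1 t)) eta (m / 2) b2 _ _ _ Heta _ _ _ _).
- intros t Ht.
  assert (H1 := Hw t ltac:(lra)).
  assert (H2 := Hw (2 * PI - t) ltac:(lra)).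
  assert (P1 := Hpos t ltac:(lra)).
  assert (P2 := Hpos (2 * PI - t) ltac:(lra)).
  unfold D, w1; auto_derive.
  + repeat split; eexists; eassumption.
  + rewrite (is_derive_unique (fun x : R => w x) _ _ H1).
    rewrite (is_derive_unique (fun x : R => w x) (2 * PI + - t) _ H2).
    unfold dD, D, w1, Atrig, Btrig.
    replace (sin (2 * PI - t)) with (- sin t)
      by (rewrite sin_minus, sin_2PI, cos_2PI; ring).
    replace (cos (2 * PI - t)) with (cos t)
      by (rewrite cos_minus, sin_2PI, cos_2PI; ring).
    field; lra.
- intros t Ht.
  assert (P1 := Hpos t ltac:(lra)).
  assert (P2 : 0 < w1 t <= M) by (apply Hpos; lra).
  assert (Hww : 0 < w t * w1 t) by nra.
  assert (Hs : 0 <= sin t) by (apply sin_ge_0; lra).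
  assert (Hsc := sin_sq_cos_sq t); assert (Hcb := COS_bound t).
  split; [apply Rmult_le_pos; [lra|left; now apply Rinv_0_lt_compat]|].
  assert (Hx : a0 * (1 - cos t) * (w t + w1 t) / (w t * w1 t)
               <= b2 * sin t * sin t / (w t * w1 t) + 4 * / c * e).
  { destruct (Rle_lt_dec t (PI - d)) as [Hle|Hlt].
    - assert (Hcos : k <= 1 + cos t).
      { assert (Hcc : cos (PI - d) <= cos t) by (apply cos_decr_1; lra).
        rewrite Rtrigo_facts.cos_pi_minus in Hcc; unfold k; lra. }
      assert (Hnum : a0 * (1 - cos t) * (w t + w1 t) <= b2 * sin t * sin t).
      { assert (Hg : (1 - cos t) * k <= sin t * sin t) by nra.
        assert (a0 * (w t + w1 t) <= b2 * k) by nra.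
        nra. }
      apply Rle_trans with (b2 * sin t * sin t / (w t * w1 t)).
      + apply Rmult_le_compat_r; [left; now apply Rinv_0_lt_compat|exact Hnum].
      + assert (0 <= e) by lra. nra.
    - assert (L1 : c <= w t) by (apply Hnear; lra).
      assert (L2 : c <= w1 t) by (apply Hnear; lra).
      assert (I1 : / w t <= / c) by (apply Rinv_le_contravar; lra).
      assert (I2 : / w1 t <= / c) by (apply Rinv_le_contravar; lra).
      assert (J1 : 0 < / w t) by (apply Rinv_0_lt_compat; lra).
      assert (J2 : 0 < / w1 t) by (apply Rinv_0_lt_compat; lra).
      replace (a0 * (1 - cos t) * (w t + w1 t) / (w t * w1 t))
        with (a0 * ((1 - cos t) * (/ w t + / w1 t))) by (field; lra).
      assert (0 <= b2 * sin t * sin t / (w t * w1 t)).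
      { apply Rmult_le_pos; [nra|left; now apply Rinv_0_lt_compat]. }
      assert (Hy : 0 <= (1 - cos t) * (/ w t + / w1 t) <= 4 * / c) by nra.
      nra. }
  unfold dD.
  replace ((a0 * (1 - cos t) * (w t + w1 t) - sin t * (D t + 2 * b2 * sin t))
             / (w t * w1 t))
    with (a0 * (1 - cos t) * (w t + w1 t) / (w t * w1 t)
          - sin t / (w t * w1 t) * (D t + b2 * sin t)
          - b2 * sin t * sin t / (w t * w1 t)) by (field; lra).
  nra.
- intros t Ht.
  assert (P1 := Hpos t ltac:(lra)).
  assert (P2 : 0 < w1 t <= M) by (apply Hpos; lra).
  assert (Hs : 1 / 2 <= sin t).
  { rewrite <- sin_PI_x, <- sin_PI6; apply sin_incr_1; lra. }
  assert (Hww : 0 < w t * w1 t) by nra.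
  assert (HwM : w t * w1 t <= M * M) by nra.
  assert (m <= / (w t * w1 t)) by (apply Rinv_le_contravar; lra).
  unfold Rdiv; nra.
- lra.
- unfold eta; nra.
- unfold D, w1; rewrite Rminus_0_r, sin_0, Hclosed; ring.
- unfold D, w1; rewrite sin_PI; replace (2 * PI - PI) with PI by ring; ring.
Qed.

(** * From the Abel equation to its reciprocal *)

(** The function [1 / (M + K * t)] decreases faster than any solution that
    meets it below level 1, so no positive solution reaches 0. *)
Lemma abel_positive (A B y : R -> R) (T alpha beta : R) :
  (forall t, 0 <= t <= T -> Rabs (A t) <= alpha /\ Rabs (B t) <= beta) ->
  (forall t, 0 <= t <= T -> is_derive y t (A t * y t ^ 3 + B t * y t ^ 2)) ->
  0 < y 0 -> forall t, 0 <= t <= T -> 0 < y t.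
Proof.
intros HAB Hy Hy0 t Ht.
assert (Hab : 0 <= alpha /\ 0 <= beta).
{ destruct (HAB t Ht); pose proof (Rabs_pos (A t)); pose proof (Rabs_pos (B t)); lra. }
assert (Hi : 0 < / y 0) by now apply Rinv_0_lt_compat.
pose (K := alpha + beta + 1).
pose (M := 1 + / y 0).
assert (Hden : forall s, 0 <= s -> 1 <= M + K * s) by (intros s Hs; unfold M, K; nra).
assert (Hb : 0 <= y t - / (M + K * t)).
{ apply (barrier (fun s => y s - / (M + K * s)) 0 T); [| |exact Ht].
  - intros s Hs.
    exists (A s * y s ^ 3 + B s * y s ^ 2 + K * (/ (M + K * s)) ^ 2); split.
    + assert (H := Hy s Hs); assert (H1 := Hden s (proj1 Hs)).
      auto_derive; [split; [eexists; eassumption|split; [lra|exact I]]|].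
      rewrite (is_derive_unique (fun x : R => y x) _ _ H); field; lra.
    + cbv beta; intros Htouch.
      assert (H1 := Hden s (proj1 Hs)).
      assert (E : / (M + K * s) = y s) by lra.
      rewrite E.
      assert (Hp : 0 < y s) by (rewrite <- E; apply Rinv_0_lt_compat; lra).
      assert (Hp1 : y s <= 1).
      { rewrite <- E, <- Rinv_1; apply Rinv_le_contravar; lra. }
      destruct (HAB s Hs) as [HA HB].
      apply Rabs_le_between in HA; apply Rabs_le_between in HB.
      assert (Hx : 0 < A s * y s + B s + K) by (unfold K; nra).
      assert (0 < y s * y s * (A s * y s + B s + K)) by (apply Rmult_lt_0_compat; nra).
      nra.
  - rewrite Rmult_0_r, Rplus_0_r.
    assert (/ M <= / / y 0) by (apply Rinv_le_contravar; unfold M; lra).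
    rewrite Rinv_inv in *; lra. }
assert (0 < / (M + K * t)); [|lra].
apply Rinv_0_lt_compat; assert (H := Hden t (proj1 Ht)); lra.
Qed.

Lemma abel_reciprocal (A B y : R -> R) (T : R) :
  (forall t, 0 <= t <= T -> is_derive y t (A t * y t ^ 3 + B t * y t ^ 2)) ->
  (forall t, 0 <= t <= T -> 0 < y t) ->
  reciprocal_solution A B 0 T (fun t => / y t).
Proof.
intros Hy Hp t Ht; assert (H := Hy t Ht); assert (P := Hp t Ht).
auto_derive; [split; [eexists; eassumption|split; [lra|exact I]]|].
rewrite (is_derive_unique (fun x : R => y x) _ _ H); field; lra.
Qed.

(** Since [w] moves at bounded speed above level 1, its order of magnitude over
    the whole interval is that of [w 0] as soon as [w 0] is large. *)
Lemma reciprocal_drift (A B w : R -> R) (T alpha beta N : R) :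
  (forall t, 0 <= t <= T -> Rabs (A t) <= alpha /\ Rabs (B t) <= beta) ->
  reciprocal_solution A B 0 T w ->
  (1 <= N -> w 0 <= N ->
   forall t, 0 <= t <= T -> w t <= N + (alpha + beta + 1) * t) /\
  (1 + (alpha + beta + 1) * T <= N -> N <= w 0 ->
   forall t, 0 <= t <= T -> N - (alpha + beta + 1) * t <= w t).
Proof.
intros HAB Hw.
set (K := alpha + beta + 1).
assert (Hspeed : forall t, 0 <= t <= T -> 1 <= w t ->
          - K < - (A t / w t) - B t < K).
{ intros t Ht Hwt; destruct (HAB t Ht) as [HA HB].
  pose proof (Rabs_pos (A t)).
  apply Rabs_le_between in HA; apply Rabs_le_between in HB.
  assert (Hi : 0 < / w t <= 1).
  { split; [apply Rinv_0_lt_compat; lra|].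
    rewrite <- Rinv_1; apply Rinv_le_contravar; lra. }
  unfold K, Rdiv; nra. }
assert (HK : forall t, 0 <= t <= T -> 0 <= K).
{ intros t Ht; destruct (HAB t Ht) as [HA HB].
  pose proof (Rabs_pos (A t)); pose proof (Rabs_pos (B t)); unfold K; lra. }
split; intros HN Hw0 t Ht; apply Rminus_le_0.
- apply (barrier (fun t => N + K * t - w t) 0 T); [|lra|exact Ht].
  clear t Ht; intros t Ht; exists (K - (- (A t / w t) - B t)); split.
  + assert (H := Hw t Ht); auto_derive; [eexists; eassumption|].
    rewrite (is_derive_unique (fun x : R => w x) _ _ H); ring.
  + cbv beta; intros Htouch.
    assert (H1 := HK t Ht).
    destruct (Hspeed t Ht) as [H2 H3]; [nra|lra].
- apply (barrier (fun t => w t - (N - K * t)) 0 T); [|lra|exact Ht].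
  clear t Ht; intros t Ht; exists (- (A t / w t) - B t + K); split.
  + assert (H := Hw t Ht); auto_derive; [eexists; eassumption|].
    rewrite (is_derive_unique (fun x : R => w x) _ _ H); ring.
  + cbv beta; intros Htouch.
    assert (H1 := HK t Ht).
    destruct (Hspeed t Ht) as [H2 H3]; [nra|lra].
Qed.

(** * Zeros of functions with a signed Wronskian *)

(** Between consecutive zeros of [A] the quotient [h / A] increases, and a zero
    of [A] is not one of [h] because the Wronskian would vanish there.  The
    function [g] is built from a solution on [[0, T]], and [h] from the
    differentiable extension of that solution. *)
Lemma wronskian_one_zero (A dA h dh g : R -> R) (T p q : R) :
  0 <= p -> q <= T ->
  A p = 0 -> A q = 0 -> (forall t, p < t < q -> A t <> 0) ->
  (forall t, p <= t <= q -> is_derive A t (dA t)) ->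
  (forall t, p <= t <= q -> is_derive h t (dh t)) ->
  (forall t, p <= t <= q -> 0 < dh t * A t - h t * dA t) ->
  (forall t, 0 <= t <= T -> h t = g t) ->
  at_most_one_simple_zero T g p q.
Proof.
intros Hp0 HqT Hp Hq Hne HA Hh HW Hg.
assert (Hin : forall t, p <= t <= q -> h t = 0 -> p < t < q).
{ intros t Ht H0; assert (H := HW t Ht); rewrite H0 in H.
  assert (t <> p) by (intros ->; rewrite Hp in H; lra).
  assert (t <> q) by (intros ->; rewrite Hq in H; lra).
  lra. }
assert (Hlt : forall s t, p <= s <= q -> p <= t <= q -> h s = 0 -> h t = 0 -> ~ s < t).
{ intros s t Hs Ht Hhs Hht Hst.
  assert (Hs' := Hin s Hs Hhs); assert (Ht' := Hin t Ht Hht).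
  destruct (MVT_cor2 (fun r => h r / A r)
              (fun r => (dh r * A r - h r * dA r) / (A r * A r)) s t Hst)
    as [z [Hz Hzi]].
  - intros r Hr; apply is_derive_Reals.
    assert (H1 := HA r ltac:(lra)); assert (H2 := Hh r ltac:(lra)).
    assert (H3 := Hne r ltac:(lra)).
    auto_derive; [repeat split; [eexists; eassumption|eexists; eassumption|exact H3]|].
    rewrite (is_derive_unique (fun x : R => h x) _ _ H2).
    rewrite (is_derive_unique (fun x : R => A x) _ _ H1); field; exact H3.
  - rewrite Hhs, Hht in Hz.
    assert (H3 := Hne z ltac:(lra)); assert (H4 := HW z ltac:(lra)).
    assert (H5 : 0 < (dh z * A z - h z * dA z) / (A z * A z)).
    { apply Rdiv_lt_0_compat; [exact H4|nra]. }
    unfold Rdiv in Hz at 1 2; rewrite !Rmult_0_l in Hz; nra. }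
split.
- intros s t Hs Ht Hgs Hgt.
  rewrite <- Hg in Hgs, Hgt by lra.
  destruct (Rtotal_order s t) as [H|[H|H]].
  + now elim (Hlt s t).
  + exact H.
  + now elim (Hlt t s).
- intros t Ht Hgt.
  assert (Hht : h t = 0) by (rewrite Hg by lra; exact Hgt).
  split; [exact Hgt|].
  exists (dh t); split.
  + intros H0; assert (H := HW t Ht); rewrite Hht, H0 in H; lra.
  + apply is_derive_D_in with h; [exact Hg|simpl; lra|apply Hh; exact Ht].
Qed.

(** * The trigonometric coefficients *)

Definition Atrig_zero (a0 : R) : R := PI - 2 * atan a0.

(** In terms of the half angle,
    [Atrig a0 t = 2 * sin (t / 2) * (a0 * sin (t / 2) - cos (t / 2))], and
    [a0] is the tangent of [atan a0]. *)
Lemma Atrig_zero_unique (a0 : R) :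
  0 < Atrig_zero a0 < 2 * PI /\ Atrig a0 (Atrig_zero a0) = 0 /\
  forall t, 0 < t < 2 * PI -> Atrig a0 t = 0 -> t = Atrig_zero a0.
Proof.
assert (Hat := atan_bound a0).
assert (Hc : 0 < cos (atan a0)) by (apply cos_gt_0; lra).
assert (Ht : sin (atan a0) = a0 * cos (atan a0)).
{ assert (H := tan_atan a0); unfold tan in H.
  rewrite <- H at 2; field; lra. }
assert (Hfac : forall t, Atrig a0 t * cos (atan a0)
                         = - 2 * sin (t / 2) * cos (t / 2 + atan a0)).
{ intros t; unfold Atrig.
  replace (sin t) with (2 * sin (t / 2) * cos (t / 2))
    by (rewrite <- sin_2a; f_equal; field).
  replace (cos t) with (1 - 2 * sin (t / 2) * sin (t / 2))
    by (rewrite <- cos_2a_sin; f_equal; field).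
  rewrite cos_plus, Ht; ring. }
unfold Atrig_zero; split; [lra|split].
- apply (Rmult_eq_reg_r (cos (atan a0))); [|lra].
  rewrite Hfac.
  replace ((PI - 2 * atan a0) / 2 + atan a0) with (PI / 2) by field.
  rewrite cos_PI2; ring.
- intros t Htr H0.
  assert (H := Hfac t); rewrite H0, Rmult_0_l in H.
  assert (0 < sin (t / 2)) by (apply sin_gt_0; lra).
  assert (Hz : cos (t / 2 + atan a0) = 0) by nra.
  destruct (Rtotal_order (t / 2 + atan a0) (PI / 2)) as [Hlt|[He|Hgt]].
  + assert (0 < cos (t / 2 + atan a0)) by (apply cos_gt_0; lra); lra.
  + lra.
  + assert (cos (t / 2 + atan a0) < 0) by (apply cos_lt_0; lra); lra.
Qed.

(** At such a zero [a0 * (1 - cos t) = sin t], and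
    [sin t ^ 2 = (1 - cos t) * (1 + cos t)]. *)
Lemma Atrig_slope_at_zero (a0 t : R) :
  0 < t < 2 * PI -> Atrig a0 t = 0 -> - cos t + a0 * sin t = 1.
Proof.
intros Ht H0; unfold Atrig in H0.
assert (Hsc := sin_sq_cos_sq t).
assert (Hs : 0 < sin (t / 2)) by (apply sin_gt_0; lra).
assert (Hcos : cos t = 1 - 2 * sin (t / 2) * sin (t / 2))
  by (rewrite <- cos_2a_sin; f_equal; field).
assert (Hg : 0 < 1 - cos t) by nra.
assert (Hsin : sin t = a0 * (1 - cos t)) by lra.
apply (Rmult_eq_reg_r (1 - cos t)); [|lra].
rewrite Hsin in *; nra.
Qed.

(** For [a0 = b0 = 0] the Wronskian [B' A - B A'] is the constant [b2]. *)
Lemma trig_wronskian (a0 b0 b1 b2 t : R) :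
  Rabs b0 <= 1 -> Rabs b0 + Rabs a0 * (1 + 2 * Rabs b1 + b2) <= b2 / 2 ->
  0 < b2 ->
  b2 / 2 <= (b1 * cos t - b2 * sin t) * Atrig a0 t
            - Btrig b0 b1 b2 t * (- cos t + a0 * sin t).
Proof.
intros Hb0 Hs Hb2; unfold Atrig, Btrig.
pose (r := b0 * sin t + b1 + b2 * sin t - b1 * cos t).
assert (Hsc := sin_sq_cos_sq t).
assert (E : (b1 * cos t - b2 * sin t) * (a0 - sin t - a0 * cos t)
            - (b0 + b1 * sin t + b2 * cos t) * (- cos t + a0 * sin t)
            = b2 * (sin t * sin t + cos t * cos t) + b0 * cos t
              - a0 * (r - b1 * (1 - (sin t * sin t + cos t * cos t))))
  by (unfold r; ring).
rewrite E, Hsc.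
assert (S1 := SIN_bound t); assert (C1 := COS_bound t).
assert (Hr : Rabs r <= 1 + 2 * Rabs b1 + b2).
{ apply Rabs_le_between in Hb0.
  assert (- Rabs b1 <= b1 <= Rabs b1) by (apply Rabs_le_between; lra).
  apply Rabs_le; unfold r; nra. }
assert (Har : a0 * r <= Rabs a0 * (1 + 2 * Rabs b1 + b2)).
{ eapply Rle_trans; [apply Rle_abs|]; rewrite Rabs_mult.
  apply Rmult_le_compat_l; [apply Rabs_pos|exact Hr]. }
assert (- Rabs b0 <= b0 <= Rabs b0) by (apply Rabs_le_between; lra).
assert (- Rabs b0 <= b0 * cos t) by nra.
lra.
Qed.

Lemma trig_bounds (a0 b0 b1 b2 t : R) :
  Rabs a0 <= 1 -> Rabs b0 <= 1 -> 0 < b2 ->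
  Rabs (Atrig a0 t) <= 3 /\ Rabs (Btrig b0 b1 b2 t) <= 1 + Rabs b1 + b2.
Proof.
intros Ha Hb Hb2; unfold Atrig, Btrig.
assert (S1 := SIN_bound t); assert (C1 := COS_bound t).
apply Rabs_le_between in Ha; apply Rabs_le_between in Hb.
assert (- Rabs b1 <= b1 <= Rabs b1) by (apply Rabs_le_between; lra).
split; apply Rabs_le; nra.
Qed.

(** The Wronskian alone fixes the signs of [B] at the zeros 0, [tA] and [2 * PI]
    of [A], where [A'] is [-1], [1] and [-1]: they are [+], [-] and [+]. *)
Lemma trig_cond_C1 (a0 b0 b1 b2 : R) :
  (forall t, 0 < (b1 * cos t - b2 * sin t) * Atrig a0 t
                 - Btrig b0 b1 b2 t * (- cos t + a0 * sin t)) ->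
  exists tB1 tB2, cond_C1 (Atrig a0) (Btrig b0 b1 b2) (2 * PI)
                    (Atrig_zero a0) tB1 tB2.
Proof.
intros HW.
destruct (Atrig_zero_unique a0) as [HtA [HA0 HAu]].
set (tA := Atrig_zero a0) in *.
assert (Hslope := Atrig_slope_at_zero a0 tA HtA HA0).
assert (Hz : Atrig a0 0 = 0) by (unfold Atrig; rewrite sin_0, cos_0; ring).
assert (Hz' : Atrig a0 (2 * PI) = 0) by (unfold Atrig; rewrite sin_2PI, cos_2PI; ring).
set (B := Btrig b0 b1 b2) in *.
assert (HB0 : 0 < B 0).
{ assert (H := HW 0); rewrite Hz, sin_0, cos_0 in H; lra. }
assert (HBT : 0 < B (2 * PI)).
{ assert (H := HW (2 * PI)); rewrite Hz', sin_2PI, cos_2PI in H; lra. }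
assert (HBA : B tA < 0).
{ assert (H := HW tA); rewrite HA0, Hslope in H; lra. }
assert (Hcont : continuity B).
{ intros t; apply derivable_continuous_pt; eexists.
  apply is_derive_Reals, Btrig_derive. }
destruct (IVT (fun t => - B t) 0 tA) as [tB1 [Hi1 Hb1]];
  [now apply continuity_opp|lra|lra|lra|].
destruct (IVT B tA (2 * PI)) as [tB2 [Hi2 Hb2]]; [assumption|lra|lra|lra|].
assert (HB1 : B tB1 = 0) by lra.
destruct (wronskian_one_zero (Atrig a0) (fun t => - cos t + a0 * sin t)
            B (fun t => b1 * cos t - b2 * sin t) B (2 * PI) 0 tA) as [U1 Z1];
  try (intros; apply Atrig_derive || apply Btrig_derive || apply HW);
  try reflexivity; try lra.
{ intros t Ht H; assert (t = tA) by (apply HAu; lra); lra. }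
destruct (wronskian_one_zero (Atrig a0) (fun t => - cos t + a0 * sin t)
            B (fun t => b1 * cos t - b2 * sin t) B (2 * PI) tA (2 * PI)) as [U2 Z2];
  try (intros; apply Atrig_derive || apply Btrig_derive || apply HW);
  try reflexivity; try lra.
{ intros t Ht H; assert (t = tA) by (apply HAu; lra); lra. }
exists tB1, tB2; split; [exact Hz|]; split; [|split; [|]].
- split; [exact HtA|]; split; [|exact HAu].
  split; [exact HA0|]; exists 1; split; [lra|].
  rewrite <- Hslope.
  apply is_derive_D_in with (Atrig a0); [reflexivity|lra|apply Atrig_derive].
- split; [apply Z1; lra|]; split; [apply Z2; lra|].
  intros t Ht H; destruct (Rle_lt_dec t tA); [left; apply U1|right; apply U2]; lra.
- assert (tB1 <> 0) by (intros E; rewrite E in HB1; lra).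
  assert (tB1 <> tA) by (intros E; rewrite E in HB1; lra).
  assert (tB2 <> tA) by (intros E; rewrite E in Hb2; lra).
  lra.
Qed.

(** Along a solution, [A y + B = y' / y ^ 2].  For [h = 2 A y + B] the terms in
    [A A' y] of the Wronskian cancel, and
    [h' A - h A' = (B' A - B A') + 2 A ^ 2 y']; similarly the cubes of [B] in
    [v] cancel, and [v = 4 A B y (A y + B) - 4 (B' A - B A')].  For small [y]
    the Wronskian of [A] and [B] decides both signs.  As [|A| <= 3] and
    [|B| <= beta], the corrections are at most [18 * (3 + beta) * y] and
    [12 * beta * (3 + beta) * y]; the smallness of [y] is a common, generous
    bound for both. *)
Lemma trig_small_C2_C3 (a0 b0 b1 b2 : R) (x y : R -> R) :
  let beta := 1 + Rabs b1 + b2 in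
  0 < b2 -> Rabs a0 <= 1 -> Rabs b0 <= 1 ->
  (forall t, b2 / 2 <= (b1 * cos t - b2 * sin t) * Atrig a0 t
                 - Btrig b0 b1 b2 t * (- cos t + a0 * sin t)) ->
  (forall t, 0 <= t <= 2 * PI -> y t = x t /\
     is_derive y t (Atrig a0 t * x t ^ 3 + Btrig b0 b1 b2 t * x t ^ 2)) ->
  (forall t, 0 <= t <= 2 * PI -> 0 < y t <= 1 /\ 37 * (3 + beta) ^ 2 * y t <= b2) ->
  cond_C2 (Atrig a0) (Btrig b0 b1 b2) (2 * PI) (Atrig_zero a0) x /\
  cond_C3 (Atrig a0) (Btrig b0 b1 b2) (2 * PI) x.
Proof.
intros beta Hb2 Ha0 Hb0 HW Hy Hsmall.
destruct (Atrig_zero_unique a0) as [HtA [HA0 HAu]].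
set (tA := Atrig_zero a0) in *.
assert (Hz : Atrig a0 0 = 0) by (unfold Atrig; rewrite sin_0, cos_0; ring).
assert (Hz' : Atrig a0 (2 * PI) = 0) by (unfold Atrig; rewrite sin_2PI, cos_2PI; ring).
assert (Hbeta : 1 <= beta) by (pose proof (Rabs_pos b1); unfold beta; lra).
assert (Hflow : forall t, 0 <= t <= 2 * PI ->
  Rabs (y t * (Atrig a0 t * y t + Btrig b0 b1 b2 t)) <= (3 + beta) * y t).
{ intros t Ht; destruct (trig_bounds a0 b0 b1 b2 t) as [HA HB]; try assumption.
  fold beta in HB; destruct (Hsmall t Ht) as [[H1 H2] _].
  rewrite Rabs_mult, (Rabs_pos_eq (y t)), Rmult_comm by lra.
  apply Rmult_le_compat_r; [lra|].
  apply Rabs_le_between in HA; apply Rabs_le_between in HB.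
  apply Rabs_le; nra. }
pose (dh := fun t => 2 * (- cos t + a0 * sin t) * y t
   + 2 * Atrig a0 t * (Atrig a0 t * y t ^ 3 + Btrig b0 b1 b2 t * y t ^ 2)
   + (b1 * cos t - b2 * sin t)).
assert (Hdh : forall t, 0 <= t <= 2 * PI ->
  is_derive (fun t => 2 * Atrig a0 t * y t + Btrig b0 b1 b2 t) t (dh t)).
{ intros t Ht; destruct (Hy t Ht) as [E H]; rewrite <- E in H.
  assert (H1 := Atrig_derive a0 t); assert (H2 := Btrig_derive b0 b1 b2 t).
  auto_derive; [repeat split; eexists; eassumption|].
  rewrite (is_derive_unique (fun x : R => y x) _ _ H).
  rewrite (is_derive_unique (fun x : R => Atrig a0 x) _ _ H1).
  rewrite (is_derive_unique (fun x : R => Btrig b0 b1 b2 x) _ _ H2).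
  unfold dh; ring. }
assert (HWh : forall t, 0 <= t <= 2 * PI ->
  0 < dh t * Atrig a0 t
      - (2 * Atrig a0 t * y t + Btrig b0 b1 b2 t) * (- cos t + a0 * sin t)).
{ intros t Ht.
  pose (z := y t * (Atrig a0 t * y t + Btrig b0 b1 b2 t)).
  replace (dh t * Atrig a0 t
      - (2 * Atrig a0 t * y t + Btrig b0 b1 b2 t) * (- cos t + a0 * sin t))
    with ((b1 * cos t - b2 * sin t) * Atrig a0 t
                 - Btrig b0 b1 b2 t * (- cos t + a0 * sin t)
          + 2 * (Atrig a0 t * Atrig a0 t) * y t * z) by (unfold dh, z; ring).
  assert (H1 := HW t); assert (H2 := Hflow t Ht); fold z in H2.
  destruct (Hsmall t Ht) as [H3 H4].
  destruct (trig_bounds a0 b0 b1 b2 t) as [HA HB]; try assumption.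
  apply Rabs_le_between in HA; apply Rabs_le_between in H2.
  assert (HAA : 0 <= Atrig a0 t * Atrig a0 t <= 9) by nra.
  assert (Hz2 : - ((3 + beta) * y t) <= y t * z).
  { assert (0 <= (3 + beta) * y t) by nra. nra. }
  assert (- (9 * ((3 + beta) * y t)) <= Atrig a0 t * Atrig a0 t * (y t * z)).
  { assert (0 <= (3 + beta) * y t) by nra. nra. }
  assert ((3 + beta) * y t * 4 <= (3 + beta) * y t * (3 + beta)) by
    (apply Rmult_le_compat_l; nra).
  nra. }
split; [split|].
- apply (wronskian_one_zero (Atrig a0) (fun t => - cos t + a0 * sin t)
    (fun t => 2 * Atrig a0 t * y t + Btrig b0 b1 b2 t) dh);
    try (intros; apply Atrig_derive || apply Hdh || apply HWh); try lra.
  + intros t Ht H; assert (t = tA) by (apply HAu; lra); lra.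
  + intros t Ht; destruct (Hy t Ht) as [E _]; now rewrite E.
- apply (wronskian_one_zero (Atrig a0) (fun t => - cos t + a0 * sin t)
    (fun t => 2 * Atrig a0 t * y t + Btrig b0 b1 b2 t) dh);
    try (intros; apply Atrig_derive || apply Hdh || apply HWh); try lra.
  + intros t Ht H; assert (t = tA) by (apply HAu; lra); lra.
  + intros t Ht; destruct (Hy t Ht) as [E _]; now rewrite E.
- intros t Ht; unfold v, P.
  destruct (Hy t Ht) as [E _]; rewrite <- E.
  rewrite (is_derive_unique _ _ _ (Atrig_derive a0 t)).
  rewrite (is_derive_unique _ _ _ (Btrig_derive b0 b1 b2 t)).
  rewrite (is_derive_unique _ _ _ (Atrig_derive a0 0)).
  assert (HB0 : 0 < Btrig b0 b1 b2 0).
  { assert (H := HW 0); rewrite Hz, sin_0, cos_0 in H; lra. }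
  rewrite (sign_eq_m1 ((- cos 0 + a0 * sin 0) * Btrig b0 b1 b2 0))
    by (rewrite sin_0, cos_0; lra).
  apply sign_eq_m1.
  assert (H1 := HW t); assert (H2 := Hflow t Ht).
  destruct (Hsmall t Ht) as [H3 H4].
  destruct (trig_bounds a0 b0 b1 b2 t) as [HA HB]; try assumption.
  fold beta in HB.
  assert (H5 : Rabs (Atrig a0 t * Btrig b0 b1 b2 t
                * (y t * (Atrig a0 t * y t + Btrig b0 b1 b2 t)))
               <= 3 * beta * ((3 + beta) * y t)).
  { rewrite !Rabs_mult in *.
    apply Rmult_le_compat; try assumption.
    - apply Rmult_le_pos; apply Rabs_pos.
    - apply Rmult_le_pos; [apply Rabs_pos|apply Rabs_pos].
    - apply Rmult_le_compat; try assumption; apply Rabs_pos. }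
  apply Rabs_le_between in H5.
  assert (0 <= (3 + beta) * y t) by nra.
  assert (3 * beta * ((3 + beta) * y t) <= 3 * ((3 + beta) ^ 2 * y t)) by nra.
  nra.
Qed.

Theorem proposition5p4 :
  forall b1 b2 : R, 0 < b2 ->
  locally_2d (fun a0 b0 : R =>
    exists tA tB1 tB2 : R,
      cond_C1 (Atrig a0) (Btrig b0 b1 b2) (2 * PI) tA tB1 tB2 /\
      forall (u : R -> R -> R) (x0 : R),
        0 < x0 ->
        singular_closed_solution (Atrig a0) (Btrig b0 b1 b2) (2 * PI) x0 u ->
        cond_C2 (Atrig a0) (Btrig b0 b1 b2) (2 * PI) tA (fun t => u t x0) /\
        cond_C3 (Atrig a0) (Btrig b0 b1 b2) (2 * PI) (fun t => u t x0))
    0 0.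
Proof.
intros b1 b2 Hb2.
pose proof PI2_1.
pose (beta := 1 + Rabs b1 + b2).
assert (Hbeta : 1 <= beta) by (pose proof (Rabs_pos b1); unfold beta; lra).
(* Reciprocals above W correspond to solutions small enough for cond_C2 and cond_C3; N is W
   plus the drift over one period, and reciprocals starting below N stay below
   N + K * (2 * PI). *)
pose (W := 1 + 37 * (3 + beta) ^ 2 / b2).
assert (HW1 : 0 < 37 * (3 + beta) ^ 2 / b2) by (apply Rdiv_lt_0_compat; nra).
assert (HWb : 37 * (3 + beta) ^ 2 <= b2 * W).
{ unfold W; replace (b2 * (1 + 37 * (3 + beta) ^ 2 / b2))
    with (b2 + 37 * (3 + beta) ^ 2) by (field; lra); lra. }
assert (HW1' : 1 <= W) by (unfold W; lra).
clearbody W.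
pose (K := 3 + beta + 1).
pose (N := W + K * (2 * PI)).
assert (HN : 1 + K * (2 * PI) <= N) by (unfold N; lra).
assert (HK : 0 <= K * (2 * PI)) by (unfold K; nra).
destruct (no_bounded_closed_reciprocal b1 b2 (N + K * (2 * PI)) Hb2) as [d1 Hd1]; [lra|].
pose (k := 2 + 2 * Rabs b1 + b2).
assert (Hk : 2 < k) by (pose proof (Rabs_pos b1); unfold k; lra).
pose (e := Rmin d1 (Rmin 1 (b2 / 2 / k))).
assert (He : 0 < e).
{ repeat apply Rmin_glb_lt; [apply cond_pos|lra|].
  repeat apply Rdiv_lt_0_compat; lra. }
exists (mkposreal e He); intros a0 b0 Ha Hb; simpl in Ha, Hb.
assert (E1 : e <= d1) by apply Rmin_l.
assert (E2 : e <= 1) by (eapply Rle_trans; [apply Rmin_r|apply Rmin_l]).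
assert (E3 : e * k <= b2 / 2).
{ apply Rle_trans with (b2 / 2 / k * k); [|right; field; lra].
  apply Rmult_le_compat_r; [lra|].
  eapply Rle_trans; [apply Rmin_r|apply Rmin_r]. }
specialize (Hd1 a0 b0 ltac:(lra) ltac:(lra)).
rewrite Rminus_0_r in Ha, Hb.
clearbody e; clear He.
assert (Hap := Rabs_pos a0); assert (Hbp := Rabs_pos b0).
assert (HWr : forall t, b2 / 2 <= (b1 * cos t - b2 * sin t) * Atrig a0 t
                 - Btrig b0 b1 b2 t * (- cos t + a0 * sin t)).
{ intros t; apply trig_wronskian; try lra.
  assert (Rabs a0 * (k - 1) <= e * (k - 1)) by (apply Rmult_le_compat_r; lra).
  unfold k in *; lra. }
destruct (trig_cond_C1 a0 b0 b1 b2) as [tB1 [tB2 HC1]].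
{ intros t; assert (H1 := HWr t); lra. }
exists (Atrig_zero a0), tB1, tB2; split; [exact HC1|].
intros u x0 Hx0 [_ [[[Hu0 Hsol] Hclosed] _]].
destruct (D_in_extend _ _ (2 * PI) ltac:(lra) Hsol) as [y Hy]; cbv beta in Hy.
assert (Hab : forall t, 0 <= t <= 2 * PI ->
          Rabs (Atrig a0 t) <= 3 /\ Rabs (Btrig b0 b1 b2 t) <= beta).
{ intros t _; apply trig_bounds; lra. }
assert (Hy' : forall t, 0 <= t <= 2 * PI ->
   is_derive y t (Atrig a0 t * y t ^ 3 + Btrig b0 b1 b2 t * y t ^ 2)).
{ intros t Ht; destruct (Hy t Ht) as [E H1]; now rewrite E. }
assert (Hy0 : y 0 = x0) by (rewrite (proj1 (Hy 0 ltac:(lra))); exact Hu0).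
assert (HyT : y (2 * PI) = x0)
  by (rewrite (proj1 (Hy (2 * PI) ltac:(lra))); exact Hclosed).
assert (Hpos : forall t, 0 <= t <= 2 * PI -> 0 < y t).
{ apply (abel_positive (Atrig a0) (Btrig b0 b1 b2) y (2 * PI) 3 beta Hab Hy'); lra. }
assert (Hrec := abel_reciprocal _ _ _ _ Hy' Hpos).
destruct (reciprocal_drift _ _ _ _ _ _ N Hab Hrec) as [Hup Hdown].
fold K in Hup, Hdown.
assert (HK0 : 0 <= K) by (unfold K; lra).
destruct (Rle_lt_dec N (/ y 0)) as [Hlarge|Hsmall].
- apply trig_small_C2_C3 with y; try lra; try assumption.
  intros t Ht; assert (P1 := Hpos t Ht).
  assert (Hw : W <= / y t).
  { assert (H1 := Hdown HN Hlarge t Ht); cbv beta in H1; unfold N in H1; nra. }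
  assert (Hyw : y t * / y t = 1) by (field; lra).
  assert (y t * W <= 1) by nra.
  fold beta.
  split; [nra|].
  assert (37 * (3 + beta) ^ 2 * y t <= b2 * W * y t) by (apply Rmult_le_compat_r; lra).
  nra.
- exfalso; apply (Hd1 (fun t => / y t)).
  + exact Hrec.
  + intros t Ht; split; [apply Rinv_0_lt_compat, Hpos; exact Ht|].
    assert (H1 := Hup ltac:(lra) ltac:(lra) t Ht); cbv beta in H1.
    nra.
  + now rewrite Hy0, HyT.
Qed.
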